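(* Let $\mathfrak{H},\mathfrak{H}_1,\mathfrak{H}_2,\mathfrak{K},\mathfrak{K}_1,\mathfrak{K}_2$ be Hilbert spaces. Let $R_i\subseteq\mathfrak{H}_i\times\mathfrak{K}$ and $C_i\subseteq\mathfrak{H}\times\mathfrak{K}_i$ be linear relations, $i\in\{1,2\}$. Then the following statements hold. (i) $\begin{pmatrix}R_1 & R_2\end{pmatrix}^*=\begin{pmatrix}R_1^*\\ R_2^*\end{pmatrix}$. (ii) $\begin{pmatrix}C_1\\ C_2\end{pmatrix}^*\supseteq\overline{\begin{pmatrix}C_1^* & C_2^*\end{pmatrix}}$, with equality if and only if $$\overline{\begin{pmatrix}C_1\\ C_2\end{pmatrix}}=\begin{pmatrix}\overline{C_1}\\ \overline{C_2}\end{pmatrix}.$$ (iii) $\begin{pmatrix}C_1^* & C_2^*\end{pmatrix}$ is closed if and only if $\operatorname{dom}\overline{C_1}+\operatorname{dom}\overline{C_2}$ is closed.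
   Context: A linear relation from a Hilbert space $X$ to a Hilbert space $Y$ is a linear subspace $A\subseteq X\times Y$ (not necessarily closed); $X\times Y$ carries the Hilbert-sum inner product. Its domain is $\operatorname{dom}A=\{x: (x,y)\in A\text{ for some }y\}$. Its adjoint is the linear relation $A^*\subseteq Y\times X$ given by $A^*=\{(y',x'): \langle x,x'\rangle_X=\langle y,y'\rangle_Y\ \text{for all }(x,y)\in A\}$. The overbar denotes the closure in $X\times Y$ (for linear relations, $\overline{A}=A^{**}$). Row: for linear relations $R_i\subseteq X_i\times Y$, $i\in\{1,2\}$, $\begin{pmatrix}R_1 & R_2\end{pmatrix}:=\{((h_1,h_2),k_1+k_2): (h_1,k_1)\in R_1,\ (h_2,k_2)\in R_2\}\subseteq (X_1\times X_2)\times Y$. Column: for linear relations $C_i\subseteq X\times Y_i$, $i\in\{1,2\}$, $\begin{pmatrix}C_1\\ C_2\end{pmatrix}:=\{(h,(k_1,k_2)): (h,k_1)\in C_1,\ (h,k_2)\in C_2\}\subseteq X\times(Y_1\times Y_2)$. *)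

(* Defs.v *)
From HB Require Import structures.
From mathcomp Require Import all_boot all_order all_algebra sesquilinear.
From mathcomp Require Import complex.
From mathcomp Require Import all_classical all_reals.
From mathcomp Require Import topology normedtype.

Set Implicit Arguments.
Unset Strict Implicit.
Unset Printing Implicit Defensive.

Import Order.TTheory GRing.Theory Num.Theory.
Local Open Scope classical_set_scope.
Local Open Scope ring_scope.

Variant scalars := RealScalars | ComplexScalars.

Definition scalar_field (R : realType) (s : scalars) : numFieldType :=
  match s with RealScalars => R | ComplexScalars => R[i] end.

Definition scalar_conj (R : realType) (s : scalars) :
    {rmorphism scalar_field R s -> scalar_field R s} :=
  match s return {rmorphism scalar_field R s -> scalar_field R s} with
  | RealScalars => idfun
  | ComplexScalars => Num.conj : {rmorphism R[i] -> R[i]}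
  end.

(* A Hilbert space is described by its uniformity rather than by its norm, so
   that [X * Y], with the library's product uniformity, is again a Hilbert
   space for the inner product <x, x'> + <y, y'>: the library's norm on [X * Y]
   is the maximum norm, which comes from no inner product.  The inner product
   is linear in its first argument; [theta] is the conjugation of the scalar
   field, i.e. [scalar_conj R s] when [K] is [scalar_field R s]. *)
HB.mixin Record PreUniformLmodule_isHilbert (K : numFieldType)
    (theta : {rmorphism K -> K}) H
    & PreUniformLmodule K H := {
  inner : {dot H for theta};
  entourage_inner : forall A : set (H * H), entourage A <->
    exists2 e : K, 0 < e & forall x y : H, inner (x - y) (x - y) < e -> A (x, y);
  inner_complete : forall F : set_system H,
    ProperFilter F -> cauchy F -> exists l : H, F --> l
}.

#[short(type="hilbertType")]
HB.structure Definition Hilbert (K : numFieldType)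
    (theta : {rmorphism K -> K}) :=
  {H of PreUniformLmodule_isHilbert K theta H & PreUniformLmodule K H}.

Section product.
Context (K : numFieldType) (theta : {rmorphism K -> K}).
Context (X Y : hilbertType theta).

Definition prod_inner (p q : X * Y) : K := inner p.1 q.1 + inner p.2 q.2.

Let prod_inner_bilinear : bilinear_for
  (GRing.Scale.Law.clone _ _ *%R _) (GRing.Scale.Law.clone _ _ (theta \; *%R) _)
  prod_inner.
Proof.
split=> [q a p p'|p a q q']; rewrite /prod_inner /=.
  by rewrite !linearPl mulrDr addrACA.
by rewrite !linearPr /= mulrDr addrACA.
Qed.

HB.instance Definition _ :=
  bilinear_isBilinear.Build K (X * Y)%type (X * Y)%type K _ _ prod_inner
    prod_inner_bilinear.

Let prod_inner_hermitian (p q : X * Y) :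
  prod_inner p q = (-1) ^+ false * theta (prod_inner q p).
Proof. by rewrite /prod_inner hermC [inner p.2 _]hermC !expr0 !mul1r rmorphD. Qed.

HB.instance Definition _ :=
  isHermitianSesquilinear.Build K (X * Y)%type false theta prod_inner
    prod_inner_hermitian.

Lemma inner_ge0 (H : hilbertType theta) (x : H) : 0 <= inner x x.
Proof.
have [->|x0] := eqVneq x 0; first by rewrite linear0l.
exact/ltW/neq0_dnorm_gt0.
Qed.

Let prod_inner_gt0 (p : X * Y) : p != 0 -> 0 < prod_inner p p.
Proof.
case: p => x y; rewrite /prod_inner /= => p0.
have [x0|x0] := eqVneq x 0.
  rewrite ltr_wpDl ?inner_ge0 // neq0_dnorm_gt0 //.
  by apply: contraNneq p0 => y0; rewrite x0 y0.
by rewrite ltr_pwDl ?inner_ge0 // neq0_dnorm_gt0.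
Qed.

HB.instance Definition _ :=
  isDotProduct.Build K (X * Y)%type prod_inner prod_inner_gt0.

Let prod_entourage_inner (A : set ((X * Y) * (X * Y))) : entourage A <->
  exists2 e : K, 0 < e & forall p q : X * Y,
    prod_inner (p - q) (p - q) < e -> A (p, q).
Proof.
split=> [[[B C]] /= [/entourage_inner[e e0 eB] /entourage_inner[f f0 fC]] BCA|].
  have cmp : e >=< f by apply: real_comparable; exact: gtr0_real.
  exists (Num.min e f) => [|[x y] [x' y']].
    by rewrite comparable_lt_min // e0 f0.
  rewrite comparable_lt_min // /prod_inner /= => /andP[pe pf].
  have Bx : B (x, x') by apply: eB; apply: le_lt_trans pe; rewrite lerDl inner_ge0.
  have Cy : C (y, y') by apply: fC; apply: le_lt_trans pf; rewrite lerDr inner_ge0.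
  by have [[[a b] [c d]] /= ? [<- <- <- <-]] := BCA ((x, x'), (y, y')) (conj Bx Cy).
move=> [e e0 eA].
have e20 : 0 < e / 2 by rewrite divr_gt0.
exists ([set xx | inner (xx.1 - xx.2) (xx.1 - xx.2) < e / 2],
        [set yy | inner (yy.1 - yy.2) (yy.1 - yy.2) < e / 2]) => /=.
  by split; apply/entourage_inner; exists (e / 2).
move=> [[x x'] [y y']] [/= lx ly].
exists ((x, y), (x', y')) => //=.
by apply: eA; rewrite /prod_inner /= [e]splitr ltrD.
Qed.

Let prod_complete (F : set_system (X * Y)) :
  ProperFilter F -> cauchy F -> exists l : X * Y, F --> l.
Proof.
move=> FF cF.
have [|x Fx] := @inner_complete K theta X (fst @ F) _.
  move=> A /entourage_inner[e e0 eA].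
  have [|[U V] /= [FU FV] UV] := cF [set pq | A (pq.1.1, pq.2.1)].
    apply/prod_entourage_inner; exists e => // p q pq; apply: eA.
    by apply: le_lt_trans pq; rewrite lerDl inner_ge0.
  exists (fst @` U, fst @` V) => /=.
    by split; rewrite /fmap /=; [apply: filterS FU|apply: filterS FV] => p ?; exists p.
  by move=> [_ _] [/= [p Up <-] [q Vq <-]]; apply: (UV (p, q)).
have [|y Fy] := @inner_complete K theta Y (snd @ F) _.
  move=> A /entourage_inner[e e0 eA].
  have [|[U V] /= [FU FV] UV] := cF [set pq | A (pq.1.2, pq.2.2)].
    apply/prod_entourage_inner; exists e => // p q pq; apply: eA.
    by apply: le_lt_trans pq; rewrite lerDr inner_ge0.
  exists (snd @` U, snd @` V) => /=.
    by split; rewrite /fmap /=; [apply: filterS FU|apply: filterS FV] => p ?; exists p.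
  by move=> [_ _] [/= [p Up <-] [q Vq <-]]; apply: (UV (p, q)).
exists (x, y) => A [[B C] /= [Bx Cy] BCA].
have FB : F (fst @^-1` B) := Fx _ Bx.
have FC : F (snd @^-1` C) := Fy _ Cy.
by apply: filterS2 FB FC => -[a b] Ba Cb; apply: BCA.
Qed.

HB.instance Definition _ := PreUniformLmodule_isHilbert.Build K theta (X * Y)%type
  prod_entourage_inner prod_complete.

End product.

Section linear_relations.
Context (K : numFieldType) (theta : {rmorphism K -> K}).
Implicit Types X Y : hilbertType theta.

Definition linear_relation X Y (A : set (X * Y)) : Prop :=
  GRing.submod_closed [in A].

Definition dom X Y (A : set (X * Y)) : set X :=
  [set x | exists y, A (x, y)].

Definition adjoint X Y (A : set (X * Y)) : set (Y * X) :=
  [set p | forall x y, A (x, y) -> inner x p.2 = inner y p.1].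

Definition row_rel X1 X2 Y (R1 : set (X1 * Y)) (R2 : set (X2 * Y)) :
    set ((X1 * X2) * Y) :=
  [set p | exists k1 k2,
    [/\ R1 (p.1.1, k1), R2 (p.1.2, k2) & p.2 = k1 + k2]].

Definition col_rel X Y1 Y2 (C1 : set (X * Y1)) (C2 : set (X * Y2)) :
    set (X * (Y1 * Y2)) :=
  [set p | C1 (p.1, p.2.1) /\ C2 (p.1, p.2.2)].

End linear_relations.

(* Main.v *)
Require Import Defs.
From HB Require Import structures.
From mathcomp Require Import all_boot all_order all_algebra.
From mathcomp Require Import sesquilinear complex ring lra.
From mathcomp Require Import all_classical all_reals topology normedtype.

(** The adjoint of a relation is the orthogonal complement of its image under a
quarter turn (x, y) |-> (y, -x) of the product ([adjoint_orth]). Hence adjoints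
are closed, and the projection theorem, in the form that the bi-orthogonal of a
subspace is its closure ([orthK]), gives A** = closure A ([biadjoint]).

(i) is a computation: testing against the pairs ((h1, 0), k) and ((0, h2), k)
splits the condition defining the adjoint of a row into two. Applied to C1* and
C2*, it says that the adjoint of the row of C1* and C2* is the column of the
closures of C1 and C2; taking the adjoint again, the closure of that row is the
adjoint of the column of the closures. Both parts of (ii) follow, since taking
adjoints reverses inclusions and loses exactly the passage to the closure.

(iii) is an instance of the theorem that, for closed subspaces M and N of a
Hilbert space, M + N is closed if and only if the sum of their orthogonal
complements is. Inside (K1 x K2) x H, the row of C1* and C2* is the sum of M,
the set of ((k1, 0), h) with (k1, h) in C1*, and of N, the set of ((0, k2), h)
with (k2, h) in C2*. In the orthogonal complement of M the second coordinate is
free, and the last one runs through dom C1** = dom (closure C1); so the sum of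
the two complements is (K1 x K2) x (dom (closure C1) + dom (closure C2)).

By bi-orthogonality only one direction of that theorem needs a proof
([closed_sum_orth]), and it rests on an angle estimate ([angle]): if M + N is
closed, then |u| <= c |u + v| for u in M + N orthogonal to M and v orthogonal
to N. If w is a limit of sums u_n + v_n, with u_n orthogonal to M and v_n to N,
the component of u_n orthogonal to M + N can be moved into v_n; the estimate
then makes u_n a Cauchy sequence, and v_n converges too. The estimate is itself
a uniform boundedness statement: were it false, there would be unit vectors z_n
in M + N, orthogonal to M and at tiny distance from the orthogonal complement
of N, so that z_n is almost orthogonal to every fixed m + n; a gliding hump
([gliding_hump]) builds a vector of M + N whose inner products with the z_n
decrease too slowly for that. *)

Set Implicit Arguments.
Unset Strict Implicit.
Unset Printing Implicit Defensive.

Import Order.TTheory GRing.Theory Num.Theory.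

Local Open Scope classical_set_scope.
Local Open Scope ring_scope.

(** * Real parts of scalars *)

Section real_part.
Context (R : realType) (s : scalars).
Local Notation K := (scalar_field R s).

Definition real_part : K -> R :=
  match s return scalar_field R s -> R with
  | RealScalars => idfun
  | ComplexScalars => @complex.Re R
  end.

Definition of_real : R -> K :=
  match s return R -> scalar_field R s with
  | RealScalars => idfun
  | ComplexScalars => real_complex R
  end.

Lemma real_partD z w : real_part (z + w) = real_part z + real_part w.
Proof. by rewrite /real_part; case: s z w => //= -[a b] [c d]. Qed.

Lemma real_part0 : real_part 0 = 0.
Proof. by rewrite /real_part; case: s. Qed.

Lemma real_partN z : real_part (- z) = - real_part z.
Proof. by rewrite /real_part; case: s z => //= -[a b]. Qed.

Lemma real_partZ a z : real_part (of_real a * z) = a * real_part z.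
Proof.
by rewrite /real_part /of_real; case: s z => //= -[b c] /=; rewrite mul0r subr0.
Qed.

Lemma real_part_conj z : real_part (scalar_conj R s z) = real_part z.
Proof. by rewrite /real_part /scalar_conj; case: s z => //= -[a b]. Qed.

Lemma of_realK a : real_part (of_real a) = a.
Proof. by rewrite /real_part /of_real; case: s. Qed.

Lemma of_real_gt0 a : 0 < a -> 0 < of_real a.
Proof. by rewrite /of_real; case: s => //= a0; rewrite ltcE /= eqxx. Qed.

Lemma real_part_ge0 z : 0 <= z -> 0 <= real_part z.
Proof.
by rewrite /real_part; case: s z => //= -[a b]; rewrite lecE /= => /andP[].
Qed.

Lemma real_part_gt0 z : 0 < z -> 0 < real_part z.
Proof.
by rewrite /real_part; case: s z => //= -[a b]; rewrite ltcE /= => /andP[].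
Qed.

Lemma real_part_lt z w : 0 <= z -> 0 <= w ->
  (real_part z < real_part w) = (z < w).
Proof.
rewrite /real_part; case: s z w => //= -[a b] [c d].
by rewrite !lecE ltcE /= => /andP[/eqP-> _] /andP[/eqP-> _]; rewrite eqxx.
Qed.

Lemma conj_mul_real_part_eq0 z : real_part (scalar_conj R s z * z) = 0 -> z = 0.
Proof.
rewrite /real_part /scalar_conj; case: s z => /=.
  by move=> z /eqP; rewrite mulf_eq0 orbb => /eqP.
move=> [a b] /= /eqP; rewrite mulNr opprK -!expr2.
rewrite paddr_eq0 ?sqr_ge0 // !sqrf_eq0 => /andP[/eqP-> /eqP->].
by [].
Qed.

End real_part.

(** * The underlying real Hilbert space *)

Section real_inner.
Context (R : realType) (s : scalars).
Local Notation K := (scalar_field R s).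
Context (H : hilbertType (scalar_conj R s)).
Implicit Types (x y z : H) (a b e : R).

(** All estimates are made for this real inner product, which treats real and
complex scalars alike. *)
Definition dotr x y : R := real_part (inner x y).

Definition nrm x : R := Num.sqrt (dotr x x).

Local Notation "a *r x" := (of_real s a *: x) (at level 40).

Lemma innerC x y : inner x y = scalar_conj R s (inner y x).
Proof. by rewrite hermC expr0 mul1r. Qed.

Lemma dotrC x y : dotr x y = dotr y x.
Proof. by rewrite /dotr innerC real_part_conj. Qed.

Lemma dotrDl x y z : dotr (x + y) z = dotr x z + dotr y z.
Proof. by rewrite /dotr linearDl /= real_partD. Qed.

Lemma dotrDr x y z : dotr z (x + y) = dotr z x + dotr z y.
Proof. by rewrite dotrC dotrDl !(dotrC z). Qed.

Lemma dotrNl x y : dotr (- x) y = - dotr x y.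
Proof. by rewrite /dotr linearNl /= real_partN. Qed.

Lemma dotrNr x y : dotr y (- x) = - dotr y x.
Proof. by rewrite dotrC dotrNl dotrC. Qed.

Lemma dotrZl a x y : dotr (a *r x) y = a * dotr x y.
Proof. by rewrite /dotr linearZl_LR /= real_partZ. Qed.

Lemma dotrZr a x y : dotr y (a *r x) = a * dotr y x.
Proof. by rewrite dotrC dotrZl dotrC. Qed.

Definition dotrE := (dotrDl, dotrDr, dotrNl, dotrNr, dotrZl, dotrZr).

Lemma dotr_ge0 x : 0 <= dotr x x.
Proof.
exact/real_part_ge0/inner_ge0.
Qed.

Lemma dotr_eq0 x : dotr x x = 0 -> x = 0.
Proof.
move=> h; apply/eqP; apply: contraT => x0.
have : 0 < real_part (inner x x) by exact/real_part_gt0/neq0_dnorm_gt0.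
by rewrite -/(dotr x x) h ltxx.
Qed.

Lemma nrm_ge0 x : 0 <= nrm x. Proof. exact: sqrtr_ge0. Qed.

Lemma nrm_sqr x : nrm x ^+ 2 = dotr x x.
Proof. by rewrite sqr_sqrtr // dotr_ge0. Qed.

Lemma nrm0 : nrm 0 = 0.
Proof. by rewrite /nrm /dotr linear0l real_part0 sqrtr0. Qed.

Lemma nrm_eq0 x : nrm x = 0 -> x = 0.
Proof. by move=> h; apply: dotr_eq0; rewrite -nrm_sqr h expr0n. Qed.

Lemma nrmN x : nrm (- x) = nrm x.
Proof. by rewrite /nrm !dotrE opprK. Qed.

Lemma nrmBC x y : nrm (x - y) = nrm (y - x).
Proof. by rewrite -nrmN opprB. Qed.

Lemma nrmZ a x : nrm (a *r x) = `|a| * nrm x.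
Proof. by rewrite /nrm !dotrE mulrA -expr2 sqrtrM ?sqr_ge0 // sqrtr_sqr. Qed.

(** After a change of sign making the product nonnegative, this is the
positivity of |y| x - |x| y. *)
Lemma cauchy_schwarz x y : `|dotr x y| <= nrm x * nrm y.
Proof.
wlog h : x / 0 <= dotr x y => [hw|].
  case: (leP 0 (dotr x y)) => [/hw//|/ltW h].
  by rewrite -normrN -dotrNl -(nrmN x) hw // dotrNl oppr_ge0.
rewrite ger0_norm //.
have [x0|x0] := eqVneq (nrm x) 0.
  by rewrite x0 mul0r (nrm_eq0 x0) /dotr linear0l real_part0.
have [y0|y0] := eqVneq (nrm y) 0.
  by rewrite y0 mulr0 (nrm_eq0 y0) dotrC /dotr linear0l real_part0.
have xy : 0 < nrm x * nrm y by rewrite mulr_gt0 // lt_def nrm_ge0 andbT.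
have := dotr_ge0 (nrm y *r x - nrm x *r y).
rewrite !dotrE (dotrC y x) -!nrm_sqr => h1.
rewrite -(ler_pM2l xy); nra.
Qed.

Lemma nrm_triangle x y : nrm (x + y) <= nrm x + nrm y.
Proof.
rewrite -(ler_pXn2r (n := 2)) ?nnegrE ?addr_ge0 ?nrm_ge0 //.
have := cauchy_schwarz x y => /ler_normlW.
rewrite nrm_sqr !dotrE (dotrC y x) -!nrm_sqr; nra.
Qed.

Lemma nrm_triangleB z x y : nrm (x - y) <= nrm (x - z) + nrm (z - y).
Proof. by have := nrm_triangle (x - z) (z - y); rewrite addrA subrK. Qed.

(** Orthogonality to a subspace can be tested on real parts: take for [a] the
conjugate of the inner product. *)
Lemma inner_eq0 x y : (forall a : K, dotr (a *: y) x = 0) -> inner y x = 0.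
Proof.
move=> h; apply: conj_mul_real_part_eq0.
by have := h (scalar_conj R s (inner y x)); rewrite /dotr linearZl_LR.
Qed.

Lemma entourage_nrm (A : set (H * H)) : entourage A <->
  exists2 e : R, 0 < e & forall x y, nrm (x - y) < e -> A (x, y).
Proof.
split=> [/entourage_inner[e e0 eA]|[e e0 eA]].
  have r0 := real_part_gt0 e0.
  exists (Num.sqrt (real_part e)); first by rewrite sqrtr_gt0.
  move=> x y h; apply: eA; rewrite -real_part_lt ?inner_ge0 ?ltW //.
  by move: h; rewrite ltr_sqrt.
apply/entourage_inner; exists (of_real s (e ^+ 2)).
  by rewrite of_real_gt0 ?exprn_gt0.
move=> x y; rewrite -real_part_lt ?inner_ge0 ?ltW ?of_real_gt0 ?exprn_gt0 //.
rewrite of_realK -/(dotr (x - y) (x - y)) -nrm_sqr => h; apply: eA.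
by rewrite -(ltr_pXn2r (n := 2)) // ?nnegrE ?nrm_ge0 ?ltW.
Qed.

Lemma closure_nrm (A : set H) x :
  closure A x <-> forall e, 0 < e -> exists2 y, A y & nrm (x - y) < e.
Proof.
split=> [cA e e0|h B].
  have [|y [Ay]] := cA (xsection [set p : H * H | nrm (p.1 - p.2) < e] x).
    by apply: nbhs_entourage; apply/entourage_nrm; exists e.
  by rewrite /xsection /= inE /=; exists y.
move=> /nbhsP[E /entourage_nrm[e e0 eE] EB].
have [y Ay xy] := h e e0; exists y; split=> //.
by apply: EB; rewrite /xsection /= inE; apply: eE.
Qed.

(** Comparing with the single term [u N] is enough for a Cauchy sequence, by the
triangle inequality. *)
Lemma cauchy_seq_limit (u : nat -> H) :
  (forall e, 0 < e -> exists N, forall n, (N <= n)%N -> nrm (u n - u N) < e) ->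
  exists l, forall e, 0 < e ->
    exists N, forall n, (N <= n)%N -> nrm (l - u n) < e.
Proof.
move=> cu.
have [|l ul] := inner_complete (u @ \oo) _.
  move=> A /entourage_nrm[e e0 eA].
  have [N uN] := cu (e / 2) ltac:(lra).
  exists (u @` [set n | (N <= n)%N], u @` [set n | (N <= n)%N]).
    by split; exists N => // n /= Nn; exists n.
  move=> [_ _] [/= [n Nn <-] [m Nm <-]]; apply: eA.
  have := nrm_triangleB (u N) (u n) (u m).
  have := uN _ Nn; have := uN _ Nm; rewrite (nrmBC (u m)); lra.
exists l => e e0.
have [|N _ h] := ul (xsection [set p : H * H | nrm (p.1 - p.2) < e] l).
  by apply: nbhs_entourage; apply/entourage_nrm; exists e.
by exists N => n /h; rewrite /xsection /= inE.
Qed.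

End real_inner.

(** * Subspaces and orthogonal complements *)

Section subspaces.
Context (R : realType) (s : scalars).
Local Notation K := (scalar_field R s).
Context (H : hilbertType (scalar_conj R s)).
Implicit Types (x y z : H) (M N S : set H) (e : R).

Definition subspace M : Prop := GRing.submod_closed [in M].

Definition sumset M N : set H := [set x + y | x in M & y in N].

Definition orth M : set H := [set x | forall y, M y -> inner y x = 0].

Lemma subspaceP M : M 0 -> (forall (a : K) x y, M x -> M y -> M (a *: x + y)) ->
  subspace M.
Proof.
by move=> M0 ML; split=> [|a x y]; rewrite !inE //; exact: ML.
Qed.

Lemma subspace0 M : subspace M -> M 0.
Proof. by case; rewrite inE. Qed.

Lemma subspaceL M (a : K) x y : subspace M -> M x -> M y -> M (a *: x + y).
Proof. by case=> _ h Mx My; have := h a x y; rewrite !inE; apply. Qed.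

Lemma subspaceD M x y : subspace M -> M x -> M y -> M (x + y).
Proof. by move=> sM Mx My; rewrite -[x]scale1r; exact: subspaceL. Qed.

Lemma subspaceZ M (a : K) x : subspace M -> M x -> M (a *: x).
Proof.
move=> sM Mx; rewrite -[a *: x]addr0.
by apply: subspaceL => //; exact: subspace0.
Qed.

Lemma subspaceB M x y : subspace M -> M x -> M y -> M (x - y).
Proof.
by move=> sM Mx My; rewrite addrC -scaleN1r; exact: subspaceL.
Qed.

Lemma subspaceN M x : subspace M -> M x -> M (- x).
Proof. by move=> sM Mx; rewrite -scaleN1r; exact: subspaceZ. Qed.

Lemma subspaceI M N : subspace M -> subspace N -> subspace (M `&` N).
Proof.
move=> sM sN; apply: subspaceP => [|a x y [? ?] [? ?]].
  by split; exact: subspace0.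
by split; exact: subspaceL.
Qed.

Lemma subspace_sumset M N : subspace M -> subspace N -> subspace (sumset M N).
Proof.
move=> sM sN; apply: subspaceP => [|a _ _ [m Mm [n Nn <-]] [m' Mm' [n' Nn' <-]]].
  by exists 0; [exact: subspace0|exists 0; [exact: subspace0|rewrite addr0]].
exists (a *: m + m'); first exact: subspaceL.
by exists (a *: n + n'); [exact: subspaceL|rewrite scalerDr addrACA].
Qed.

Lemma sub_sumsetl M N : subspace N -> M `<=` sumset M N.
Proof.
by move=> sN x Mx; exists x => //; exists 0; [exact: subspace0|rewrite addr0].
Qed.

Lemma sub_sumsetr M N : subspace M -> N `<=` sumset M N.
Proof.
by move=> sM x Nx; exists 0; [exact: subspace0|exists x; rewrite ?add0r].
Qed.

Lemma subspace_orth M : subspace (orth M).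
Proof.
apply: subspaceP => [y _|a x y Mx My z Mz]; first by rewrite linear0r.
by rewrite linearPr /= Mx // My // mulr0 addr0.
Qed.

#[local] Hint Resolve subspace_orth : core.

Lemma orthS M N : M `<=` N -> orth N `<=` orth M.
Proof. by move=> MN x Nx y /MN/Nx. Qed.

Lemma sub_orthK M : M `<=` orth (orth M).
Proof.
by move=> x Mx y /(_ x Mx) xy; rewrite innerC xy rmorph0.
Qed.

Lemma dotr_orth M x y : M x -> orth M y -> dotr x y = 0.
Proof. by move=> Mx /(_ _ Mx) h; rewrite /dotr h real_part0. Qed.

Lemma closed_nrm M :
  (forall x, (forall e, 0 < e -> exists2 y, M y & nrm (x - y) < e) -> M x) ->
  closed M.
Proof. by move=> h x /closure_nrm /h. Qed.

Lemma limit_closed M (u : nat -> H) x : closed M -> (forall n, M (u n)) ->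
  (forall e, 0 < e -> exists k, forall n, (k <= n)%N -> nrm (x - u n) < e) ->
  M x.
Proof.
move=> cM Mu ux; apply: cM; apply/closure_nrm => e /ux[k uk].
by exists (u k); rewrite ?uk.
Qed.

(** If x is a limit of elements z of the complement of M and y is in M, then
<a y, x> = <a y, x - z> is arbitrarily small for each scalar a. *)
Lemma closed_orth M : closed (orth M).
Proof.
apply: closed_nrm => x xM y My; apply: inner_eq0 => a.
apply/eqP; apply: contraT => h.
have p : 0 < nrm (a *: y) + 1 by have := nrm_ge0 (a *: y); lra.
have [|z Mz xz] := xM (`|dotr (a *: y) x| / (nrm (a *: y) + 1)).
  by rewrite divr_gt0 ?normr_gt0.
have := cauchy_schwarz (a *: y) (x - z).
have az : dotr (a *: y) z = 0.
  by rewrite /dotr linearZl_LR /= (Mz _ My) mulr0 real_part0.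
rewrite dotrDr dotrNr az subr0.
move: xz; rewrite ltr_pdivlMr // => h1 h2.
have := nrm_ge0 (x - z); have h3 : 0 < `|dotr (a *: y) x| by rewrite normr_gt0.
nra.
Qed.

(** The step along y that minimises the distance to x; the gain is what makes a
nearly closest point nearly orthogonal. *)
Lemma dotr_reject x y : 0 < nrm y ->
  dotr (x - of_real s (dotr y x / nrm y ^+ 2) *: y)
       (x - of_real s (dotr y x / nrm y ^+ 2) *: y) =
  dotr x x - (dotr y x / nrm y) ^+ 2.
Proof.
by move=> y0; rewrite !dotrE (dotrC x y) -(nrm_sqr y); field; rewrite gt_eqF.
Qed.

Lemma inv_nat_lt e : 0 < e -> exists k, forall n, (k <= n)%N -> n.+1%:R^-1 < e.
Proof.
move=> e0; exists (Num.truncn e^-1) => n Nn.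
rewrite -[ltRHS]invrK ltf_pV2 ?posrE ?invr_gt0 //.
apply: lt_le_trans (truncnS_gt _) _.
by rewrite ler_nat.
Qed.

(** A sequence minimising the distance from x to M is Cauchy by the
parallelogram identity, applied to the midpoints, which are in M too. By
[dotr_reject] the differences from x are asymptotically orthogonal to M. *)
Lemma projection M x : subspace M -> exists2 m, closure M m & orth M (x - m).
Proof.
move=> sM; pose D := [set dotr (x - m) (x - m) | m in M].
have hD : has_inf D.
  split; first by exists (dotr (x - 0) (x - 0)), 0 => //; exact: subspace0.
  by exists 0 => _ [m _ <-]; exact: dotr_ge0.
have Dle m : M m -> inf D <= dotr (x - m) (x - m).
  by move=> Mm; apply: ge_inf; [exact: hD.2|exists m].
have /choice[u uP] n :
    exists m, M m /\ dotr (x - m) (x - m) < inf D + n.+1%:R^-1.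
  have [|_ [m Mm <-] h] := inf_adherent (eps := n.+1%:R^-1) _ hD.
    by rewrite invr_gt0.
  by exists m.
(* Parallelogram identity, with every square norm expanded. *)
have uB n m (e : R) : n.+1%:R^-1 < e -> m.+1%:R^-1 < e ->
    dotr (u n - u m) (u n - u m) < 4 * e.
  move=> ne me.
  have [Mn hn] := uP n; have [Mm hm] := uP m.
  have := Dle _ (subspaceZ (of_real s 2^-1) sM (subspaceD sM Mn Mm)).
  move: hn hm; rewrite !dotrE (dotrC x (u n)) (dotrC x (u m)) (dotrC (u m) (u n)).
  move: ne me; move: (n.+1%:R^-1) (m.+1%:R^-1) => en em; lra.
have [e e0|m um] := @cauchy_seq_limit _ _ _ u.
  have [k hk] := @inv_nat_lt (e ^+ 2 / 4) ltac:(rewrite divr_gt0 ?exprn_gt0 //).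
  exists k => n kn.
  rewrite -(ltr_pXn2r (n := 2)) ?nnegrE ?nrm_ge0 ?(ltW e0) // nrm_sqr.
  have := uB n k _ (hk _ kn) (hk _ (leqnn k)); lra.
have clM : closure M m.
  by apply/closure_nrm => e /um[k hk]; exists (u k); [exact: (uP k).1|exact: hk].
exists m => // y0 My0; apply: inner_eq0 => a; set y := a *: y0.
have My : M y by exact: subspaceZ.
apply/eqP; apply: contraT => h; set d := `|dotr y (x - m)|.
have d0 : 0 < d by rewrite normr_gt0.
have y1 : 0 < nrm y.
  rewrite lt_def nrm_ge0 andbT; apply: contraNneq h => /nrm_eq0->.
  by rewrite /dotr linear0l real_part0.
have [k hk] := um (d / 2 / nrm y) ltac:(by rewrite !divr_gt0).
have [l hl] := @inv_nat_lt ((d / 2 / nrm y) ^+ 2)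
  ltac:(by rewrite exprn_gt0 ?divr_gt0).
pose n := maxn k l.
have {}hk := hk n (leq_maxl _ _).
have {}hl := hl n (leq_maxr _ _).
have [Mn hn] := uP n.
pose t := dotr y (x - u n) / nrm y ^+ 2.
have := Dle _ (subspaceD sM Mn (subspaceZ (of_real s t) sM My)).
rewrite opprD addrA dotr_reject // => hD1.
have g2 : (dotr y (x - u n) / nrm y) ^+ 2 < (d / 2 / nrm y) ^+ 2.
  by move: hn hl hD1; move: (n.+1%:R^-1) => en; lra.
have g1 : `|dotr y (x - u n)| < d / 2.
  have := g2; rewrite -(real_normK (num_real (_ / _))).
  rewrite ltr_pXn2r ?nnegrE ?normr_ge0 ?divr_ge0 ?nrm_ge0 ?(ltW d0) //.
  by rewrite normrM [`|_^-1|]gtr0_norm ?invr_gt0 // ltr_pM2r ?invr_gt0.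
have := cauchy_schwarz y (m - u n).
have := hk; rewrite ltr_pdivlMr // => hk1 cs.
have : d <= `|dotr y (x - u n)| + `|dotr y (m - u n)|.
  have -> : d = `|dotr y (x - u n) - dotr y (m - u n)|.
    by rewrite -dotrNr -dotrDr opprB addrA subrK.
  exact: ler_normB.
lra.
Qed.

Lemma orthK M : subspace M -> orth (orth M) = closure M.
Proof.
move=> sM; apply/seteqP; split=> [x xM|]; last first.
  rewrite [X in _ `<=` X](iffLR (closure_id _) (@closed_orth _)).
  exact/closure_subset/sub_orthK.
have [m Mm xm] := projection x sM.
suff -> : x = m by [].
have mM : orth (orth M) m.
  rewrite (iffLR (closure_id _) (@closed_orth (orth M))).
  exact: closure_subset (@sub_orthK M) _ Mm.
apply/eqP; rewrite -subr_eq0; apply/eqP/dotr_eq0; rewrite /dotr.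
by rewrite (subspaceB (subspace_orth _) xM mM _ xm) real_part0.
Qed.

(** The vector is the sum of the series of terms +- 3^-n z_n.  The sign of the
n-th term is chosen so that adding it cannot bring the product with z_n below
3^-n in absolute value; all later terms together have norm at most 3^-n / 2. *)
Lemma gliding_hump S (z : nat -> H) : subspace S -> closed S ->
  (forall n, S (z n)) -> (forall n, nrm (z n) = 1) ->
  exists2 x, S x & forall n, 3^-1 ^+ n / 2 <= `|dotr (z n) x|.
Proof.
move=> sS cS Sz z1.
pose q n : R := 3^-1 ^+ n.
have qS n : q n.+1 = q n / 3 by rewrite /q exprS mulrC.
have q0 n : 0 < q n by rewrite exprn_gt0 // invr_gt0.
pose sg x n : R := if 0 <= dotr (z n) x then 1 else -1.
pose fix u n : H := if n is n'.+1
  then u n' + of_real s (sg (u n') n' * q n') *: z n' else 0.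
have Su n : S (u n).
  elim: n => [|n IH] /=; first exact: subspace0.
  by apply: subspaceD => //; exact: subspaceZ.
have hump n : q n <= `|dotr (z n) (u n.+1)|.
  rewrite /= dotrDr dotrZr -nrm_sqr z1 expr1n mulr1 /sg.
  have := q0 n; case: (leP 0 (dotr (z n) (u n))) => h hq.
    rewrite mul1r ger0_norm; lra.
  rewrite mulN1r ltr0_norm; lra.
have step n k : nrm (u (n + k)%N - u n) <= q n * 3 / 2 - q (n + k)%N * 3 / 2.
  elim: k => [|k IH]; first by rewrite addn0 !subrr nrm0.
  have := nrm_triangleB (u (n + k)%N) (u (n + k.+1)%N) (u n).
  have -> : u (n + k.+1)%N - u (n + k)%N =
      of_real s (sg (u (n + k)%N) (n + k)%N * q (n + k)%N) *: z (n + k)%N.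
    by rewrite addnS /= addrAC subrr add0r.
  rewrite nrmZ z1 mulr1 addnS qS.
  suff -> : `|sg (u (n + k)%N) (n + k)%N * q (n + k)%N| = q (n + k)%N by lra.
  by rewrite normrM [`|q _|]gtr0_norm // /sg; case: ifP => _;
    rewrite ?normrN1 ?normr1 mul1r.
have q_lt e : 0 < e -> exists k, q k < e.
  move=> /inv_nat_lt[k hk]; exists k.+1; apply: lt_trans (hk _ (leqnn k)).
  rewrite /q exprVn ltf_pV2 ?posrE ?exprn_gt0 // -natrX ltr_nat.
  exact: ltn_expl.
have [e e0|x ux] := @cauchy_seq_limit _ _ _ u.
  have [k hk] := q_lt (e / 2) ltac:(by rewrite divr_gt0).
  exists k => n kn; have := step k (n - k)%N; rewrite subnKC // => h.
  have := q0 n; lra.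
exists x; first exact: limit_closed cS Su ux.
move=> n; rewrite -/(q n).
have xu : nrm (x - u n.+1) <= q n / 2.
  rewrite leNgt; apply/negP => h.
  have [k hk] := ux (nrm (x - u n.+1) - q n / 2) ltac:(by rewrite subr_gt0).
  have := hk (n.+1 + k)%N (leq_addl _ _).
  have := step n.+1 k; have := nrm_triangleB (u (n.+1 + k)%N) x (u n.+1).
  have := q0 (n.+1 + k)%N; rewrite qS; lra.
have := cauchy_schwarz (z n) (u n.+1 - x); rewrite z1 mul1r nrmBC => cs.
have := hump n.
rewrite -[u n.+1](subrK x) dotrDr => h.
have := ler_normD (dotr (z n) (u n.+1 - x)) (dotr (z n) x); lra.
Qed.

(** Otherwise there are unit vectors z_n in S, the part of M + N orthogonal to
M, and v_n orthogonal to N, with |z_n + v_n| <= 3^-n / (n + 1). For a sum m +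
n' in S, <z_n, m + n'> = <z_n + v_n, n'> is at most |n'| 3^-n / (n + 1),
contrary to the gliding hump lower bound 3^-n / 2 once n is large. *)
Lemma angle M N : subspace M -> subspace N -> closed (sumset M N) ->
  exists2 c, 0 < c & forall u v, orth M u -> sumset M N u -> orth N v ->
    nrm u <= c * nrm (u + v).
Proof.
move=> sM sN cMN; apply: contrapT => h.
pose S := orth M `&` sumset M N.
have sS : subspace S.
  by apply/subspaceI/subspace_sumset => //; exact: subspace_orth.
have cS : closed S by apply: closedI => //; exact: closed_orth.
have /choice[z] n : exists z, [/\ S z, nrm z = 1 &
    exists2 v, orth N v & nrm (z + v) <= 3^-1 ^+ n / n.+1%:R].
  apply: contrapT => hn; apply: h; pose c : R := 3 ^+ n * n.+1%:R.
  have c0 : 0 < c by rewrite mulr_gt0 ?exprn_gt0.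
  exists c => // u v Mu MNu Nv.
  rewrite leNgt; apply/negP => huv.
  have u0 : 0 < nrm u.
    by apply: le_lt_trans huv; rewrite mulr_ge0 ?nrm_ge0 ?(ltW c0).
  apply: hn; exists (of_real s (nrm u)^-1 *: u); split.
  - by apply: subspaceZ.
  - by rewrite nrmZ ger0_norm ?mulVf ?gt_eqF // invr_ge0 ltW.
  exists (of_real s (nrm u)^-1 *: v).
    exact: (subspaceZ _ (@subspace_orth N) Nv).
  rewrite -scalerDr nrmZ ger0_norm ?invr_ge0 ?(ltW u0) //.
  by rewrite exprVn -invfM -/c mulrC ler_pdivrMr // mulrC ler_pdivlMr // mulrC ltW.
move=> zP.
have Sz n : S (z n) by have [] := zP n.
have z1 n : nrm (z n) = 1 by have [] := zP n.
have [x Sx xz] := gliding_hump sS cS Sz z1.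
have arith (C a d Q i : R) : a <= Q * i -> 0 <= C -> 0 < Q -> 0 < i ->
    i * (2 * (C + 1)) < 1 -> d <= a * C -> Q / 2 <= d -> False.
  move=> aQi C0 Q0 i0 iC daC Qd.
  have h1 : a * C <= Q * i * C by rewrite ler_wpM2r.
  have h2 : Q * (i * (2 * (C + 1))) < Q * 1 by rewrite ltr_pM2l.
  have h3 : 0 < Q * i by rewrite mulr_gt0.
  lra.
have [xM [m Mm [n Nn mn]]] := Sx.
have [k hk] := inv_nat_lt (e := (2 * (nrm n + 1))^-1)
  ltac:(rewrite invr_gt0; have := nrm_ge0 n; lra).
have [[zM _] _ [v Nv zv]] := zP k.
have := xz k.
rewrite -mn dotrDr (dotrC _ m) (dotr_orth Mm zM) add0r.
have -> : dotr (z k) n = dotr (z k + v) n.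
  by rewrite dotrDl (dotrC v) (dotr_orth Nn Nv) addr0.
have := cauchy_schwarz (z k + v) n.
have := hk k (leqnn k); rewrite -[ltRHS]div1r ltr_pdivlMr; last first.
  by have := nrm_ge0 n; lra.
have : 0 < k.+1%:R^-1 :> R by rewrite invr_gt0.
have : 0 < 3^-1 ^+ k :> R by rewrite exprn_gt0 // invr_gt0.
have := nrm_ge0 n.
exact: arith zv.
Qed.

(** In a convergent sequence of sums u_n + v_n, the u_n are only determined up to
elements orthogonal to both M and N. Projecting them onto M + N removes this
freedom, and the angle estimate turns
convergence of u_n + v_n into convergence of u_n. *)
Lemma closed_sum_orth M N : subspace M -> subspace N -> closed (sumset M N) ->
  closed (sumset (orth M) (orth N)).
Proof.
move=> sM sN cMN; have [c c0 hc] := angle sM sN cMN.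
have sMN := subspace_sumset sM sN.
apply: closed_nrm => w hw.
have /choice[u uP] n : exists u, [/\ orth M u, sumset M N u &
    exists2 v, orth N v & nrm (w - (u + v)) < n.+1%:R^-1].
  have [|_ [u Mu [v Nv <-]] uv] := hw n.+1%:R^-1; first by rewrite invr_gt0.
  have [p] := projection u sMN; rewrite -(iffLR (closure_id _) cMN) => pMN up.
  have upM : orth M (u - p) by apply: orthS up; exact: sub_sumsetl.
  have upN : orth N (u - p) by apply: orthS up; exact: sub_sumsetr.
  exists p; split=> //.
    have -> : p = u - (u - p) by rewrite subKr.
    exact: (subspaceB _ Mu upM).
  exists (u - p + v); first exact: (subspaceD _ upN Nv).
  by rewrite addrA addrCA subrr addr0.
have /choice[v vP] n : exists v, orth N v /\ nrm (w - (u n + v)) < n.+1%:R^-1.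
  by have [_ _ [v]] := uP n; exists v.
have [e e0|l ul] := @cauchy_seq_limit _ _ _ u.
  have [k hk] := @inv_nat_lt (e / (2 * c)) ltac:(by rewrite divr_gt0 ?mulr_gt0).
  exists k => n kn.
  have [Mun MNun _] := uP n; have [Muk MNuk _] := uP k.
  have [Nvn wn] := vP n; have [Nvk wk] := vP k.
  have hcn : nrm (u n - u k) <= c * nrm (u n + v n - (u k + v k)).
    rewrite opprD addrACA; apply: hc.
    - exact: (subspaceB _ Mun Muk).
    - exact: (subspaceB _ MNun MNuk).
    - exact: (subspaceB _ Nvn Nvk).
  have tr := nrm_triangleB w (u n + v n) (u k + v k).
  rewrite (nrmBC (u n + v n) w) in tr.
  have hw1 : nrm (u n + v n - (u k + v k)) < e / c.
    have -> : e / c = e / (2 * c) + e / (2 * c) by field; rewrite gt_eqF.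
    apply: le_lt_trans tr _; apply: ltrD.
      exact: lt_trans wn (hk _ kn).
    exact: lt_trans wk (hk _ (leqnn k)).
  by apply: le_lt_trans hcn _; rewrite mulrC -ltr_pdivlMr.
exists l; first by apply: limit_closed ul => [|n];
  [exact: closed_orth|have [] := uP n].
exists (w - l); last by rewrite addrC subrK.
apply: (@limit_closed _ v) => [|n|e e0]; first exact: closed_orth.
  exact: (vP n).1.
have [k1 hk1] := ul (e / 2) ltac:(by rewrite divr_gt0).
have [k2 hk2] := @inv_nat_lt (e / 2) ltac:(by rewrite divr_gt0).
exists (maxn k1 k2) => n; rewrite geq_max => /andP[/hk1 h1 /hk2 h2].
have := (vP n).2; have := nrm_triangleB (u n) (w - v n) l.
rewrite opprD addrA (addrAC w (- v n) (- l)) (addrAC w (- v n)) (nrmBC (u n)).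
move: h1 h2; move: (n.+1%:R^-1) => a; lra.
Qed.
End subspaces.

(** * Complements in a larger space *)

Section coisometry.
Context (R : realType) (s : scalars) (E F : hilbertType (scalar_conj R s)).
Context (J : E -> F) (P : F -> E).
Hypotheses (PL : linear P) (JP : forall x y, inner (J x) y = inner x (P y)).
Hypothesis (PJ : cancel J P).

Lemma orth_image (A : set E) : orth (J @` A) = P @^-1` orth A.
Proof.
apply/seteqP; split=> x /= h y; first by move=> Ay; rewrite -JP; apply: h; exists y.
by move=> [a Aa <-]; rewrite JP; exact: h.
Qed.

(** P is the adjoint of the isometry J. Its kernel is contained in the
preimage, so a vector x orthogonal to the preimage is orthogonal to x - J (P
x), hence equal to J (P x). *)
Lemma orth_preimage (A : set E) : A 0 -> orth (P @^-1` A) = J @` orth A.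
Proof.
move=> A0; apply/seteqP; split=> [x xA|_ [a aA <-] y Ay]; last first.
  by rewrite innerC JP -innerC; exact: aA.
exists (P x) => [a Aa|]; first by rewrite -JP; apply: xA; rewrite /= PJ.
have P0 : P (x - J (P x)) = 0.
  by rewrite addrC -scaleN1r PL PJ scaleN1r addNr.
apply/esym/eqP; rewrite -subr_eq0; apply/eqP/dotr_eq0.
rewrite /dotr linearBr /= [X in _ - X]innerC JP P0 linear0r rmorph0 subr0.
by rewrite xA /= ?P0 // real_part0.
Qed.

End coisometry.

(** * Adjoints of relations, rows and columns *)

Section adjoint.
Context (R : realType) (s : scalars).
Implicit Types X Y : hilbertType (scalar_conj R s).

Lemma inner_pair X Y (p q : X * Y) : inner p q = inner p.1 q.1 + inner p.2 q.2.
Proof. by []. Qed.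

(** The image of A under (x, y) |-> (y, -x). *)
Definition quarter_turn X Y (A : set (X * Y)) : set (Y * X) :=
  [set p | A (- p.2, p.1)].

Lemma adjoint_orth X Y (A : set (X * Y)) : adjoint A = orth (quarter_turn A).
Proof.
apply/seteqP; split=> [p Ap q Aq|p Ap x y Axy].
  by have /= h := Ap _ _ Aq; rewrite inner_pair -h linearNl /= addNr.
have := Ap (y, - x); rewrite /quarter_turn /= opprK => /(_ Axy) /eqP.
by rewrite inner_pair /= linearNl subr_eq0 => /eqP.
Qed.

Lemma orth_adjoint X Y (A : set (X * Y)) : quarter_turn (adjoint A) = orth A.
Proof.
apply/seteqP; split=> [p Ap [x y] Axy|p Ap x y Axy].
  have := Ap _ _ Axy => /= h.
  by rewrite inner_pair /= h linearNr /= addNr.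
have := Ap _ Axy; rewrite inner_pair /= linearNr => /eqP.
by rewrite addr_eq0 => /eqP.
Qed.

Lemma linear_adjoint X Y (A : set (X * Y)) : linear_relation (adjoint A).
Proof. by rewrite adjoint_orth; exact: subspace_orth. Qed.

Lemma closed_adjoint X Y (A : set (X * Y)) : closed (adjoint A).
Proof. by rewrite adjoint_orth; exact: closed_orth. Qed.

Lemma closure_adjoint X Y (A : set (X * Y)) : closure (adjoint A) = adjoint A.
Proof. by rewrite -(iffLR (closure_id _) (@closed_adjoint _ _ A)). Qed.

(** Turning the adjoint back gives the orthogonal complement of A, so the
adjoint of the adjoint is the bi-orthogonal of A. *)
Lemma biadjoint X Y (A : set (X * Y)) : linear_relation A ->
  adjoint (adjoint A) = closure A.
Proof. by move=> sA; rewrite adjoint_orth orth_adjoint orthK. Qed.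

Lemma adjointS X Y (A B : set (X * Y)) : A `<=` B -> adjoint B `<=` adjoint A.
Proof. by move=> AB p Bp x y /AB; exact: Bp. Qed.

(** A*** is both the adjoint of A** = closure A and the closure of A*. *)
Lemma adjoint_closure X Y (A : set (X * Y)) : linear_relation A ->
  adjoint (closure A) = adjoint A.
Proof.
move=> sA; rewrite -biadjoint // biadjoint ?closure_adjoint //.
exact: linear_adjoint.
Qed.

Lemma linear_row X1 X2 Y (A : set (X1 * Y)) (B : set (X2 * Y)) :
  linear_relation A -> linear_relation B -> linear_relation (row_rel A B).
Proof.
move=> sA sB; apply: subspaceP.
  exists 0, 0; split; rewrite ?addr0 //.
  - exact: (subspace0 sA).
  - exact: (subspace0 sB).
move=> a p q [k1 [k2 [A1 B1 e1]]] [l1 [l2 [A2 B2 e2]]].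
exists (a *: k1 + l1), (a *: k2 + l2); split.
- exact: (subspaceL a sA A1 A2).
- exact: (subspaceL a sB B1 B2).
- by rewrite /= e1 e2 scalerDr addrACA.
Qed.

Lemma linear_col X Y1 Y2 (A : set (X * Y1)) (B : set (X * Y2)) :
  linear_relation A -> linear_relation B -> linear_relation (col_rel A B).
Proof.
move=> sA sB; apply: subspaceP.
  by split; [exact: (subspace0 sA)|exact: (subspace0 sB)].
move=> a p q [A1 B1] [A2 B2]; split.
- exact: (subspaceL a sA A1 A2).
- exact: (subspaceL a sB B1 B2).
Qed.

Lemma adjoint_row X1 X2 Y (A : set (X1 * Y)) (B : set (X2 * Y)) :
  linear_relation A -> linear_relation B ->
  adjoint (row_rel A B) = col_rel (adjoint A) (adjoint B).
Proof.
move=> sA sB; apply/seteqP; split=> [[y [x1 x2]] h|[y [x1 x2]] [h1 h2]].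
  split=> x k Axk.
    have := h (x, 0) k; rewrite inner_pair /= linear0l addr0; apply.
    by exists k, 0; split; rewrite ?addr0 //; exact: (subspace0 sB).
  have := h (0, x) k; rewrite inner_pair /= linear0l add0r; apply.
  by exists 0, k; split; rewrite ?add0r //; exact: (subspace0 sA).
move=> [a1 a2] k [k1 [k2 [/= A1 B2 ->]]].
by rewrite inner_pair /= linearDl /= (h1 _ _ A1) (h2 _ _ B2).
Qed.

Lemma adjoint_row_adjoint X Y1 Y2 (C1 : set (X * Y1)) (C2 : set (X * Y2)) :
  linear_relation C1 -> linear_relation C2 ->
  adjoint (row_rel (adjoint C1) (adjoint C2)) =
  col_rel (closure C1) (closure C2).
Proof.
by move=> s1 s2; rewrite adjoint_row ?biadjoint //; exact: linear_adjoint.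
Qed.

Lemma closure_row_adjoint X Y1 Y2 (C1 : set (X * Y1)) (C2 : set (X * Y2)) :
  linear_relation C1 -> linear_relation C2 ->
  closure (row_rel (adjoint C1) (adjoint C2)) =
  adjoint (col_rel (closure C1) (closure C2)).
Proof.
move=> s1 s2; rewrite -adjoint_row_adjoint // biadjoint //.
by apply: linear_row; exact: linear_adjoint.
Qed.

Lemma closure_row_sub_adjoint_col X Y1 Y2 (C1 : set (X * Y1))
    (C2 : set (X * Y2)) :
  linear_relation C1 -> linear_relation C2 ->
  closure (row_rel (adjoint C1) (adjoint C2)) `<=` adjoint (col_rel C1 C2).
Proof.
move=> s1 s2; rewrite closure_row_adjoint //; apply: adjointS => p [h1 h2].
by split; exact: subset_closure.
Qed.

(** The right-hand side of the first equality is the adjoint of the column of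
the closures, which is itself an adjoint, hence closed. Two linear
relations have the same adjoint exactly when they have the same closure. *)
Lemma adjoint_col_eq X Y1 Y2 (C1 : set (X * Y1)) (C2 : set (X * Y2)) :
  linear_relation C1 -> linear_relation C2 ->
  adjoint (col_rel C1 C2) = closure (row_rel (adjoint C1) (adjoint C2)) <->
  closure (col_rel C1 C2) = col_rel (closure C1) (closure C2).
Proof.
move=> s1 s2; have sC := linear_col s1 s2.
rewrite closure_row_adjoint //; split=> [h|<-]; last by rewrite adjoint_closure.
rewrite -(biadjoint sC) h -adjoint_row_adjoint // biadjoint ?closure_adjoint //.
exact: linear_adjoint.
Qed.

Lemma closed_preimage_snd X Y (S : set Y) :
  closed [set p : X * Y | S p.2] <-> closed S.
Proof.
split=> cS; last first.
  by apply: (preimage_closed (f := snd)) => // p _; exact: cvg_snd.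
apply: closed_nrm => y yS; apply: (cS (0, y)).
apply/closure_nrm => e /yS[z Sz yz]; exists (0, z) => //.
by rewrite /nrm /dotr inner_pair /= subrr linear0l add0r.
Qed.

(** ** The row as a sum of two subspaces *)

Section row_as_sum.
Context (X Y1 Y2 : hilbertType (scalar_conj R s)).
Context (A : set (Y1 * X)) (B : set (Y2 * X)).

Definition inl_pair (p : Y1 * X) : (Y1 * Y2) * X := ((p.1, 0), p.2).
Definition fst_pair (p : (Y1 * Y2) * X) : Y1 * X := (p.1.1, p.2).
Definition inr_pair (p : Y2 * X) : (Y1 * Y2) * X := ((0, p.1), p.2).
Definition snd_pair (p : (Y1 * Y2) * X) : Y2 * X := (p.1.2, p.2).

Lemma row_sumset : row_rel A B = sumset (inl_pair @` A) (inr_pair @` B).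
Proof.
apply/seteqP; split=> [[[a b] x] [k1 [k2 [/= Ak1 Bk2 ->]]]|].
  exists ((a, 0), k1); first by exists (a, k1).
  exists ((0, b), k2); first by exists (b, k2).
  by congr ((_, _), _); rewrite /= ?addr0 ?add0r.
move=> _ [_ [[a k1] Ak1 <-] [_ [[b k2] Bk2 <-] <-]].
by exists k1, k2; rewrite /= addr0 add0r.
Qed.

Lemma dom_biadjoint (C : set (X * Y1)) x : linear_relation C ->
  dom (closure C) x <-> exists y, orth (adjoint C) (y, x).
Proof.
move=> sC; rewrite -biadjoint // -orth_adjoint.
have sCC := linear_adjoint (adjoint C).
split=> -[y Cy]; exists (- y); first exact: (subspaceN sCC Cy).
by have := subspaceN sCC Cy; rewrite -[- (_, _)]/(- - x, - y) opprK.
Qed.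

End row_as_sum.

(** The closed-sum theorem for the summands M and N of the row.  It is used for
M and N in one direction and for their complements in the other; the latter
needs that M and N are their own bi-orthogonals, as C1* and C2* are closed. *)
Lemma closed_row_adjoint X Y1 Y2 (C1 : set (X * Y1)) (C2 : set (X * Y2)) :
  linear_relation C1 -> linear_relation C2 ->
  closed (row_rel (adjoint C1) (adjoint C2)) <->
  closed (sumset (dom (closure C1)) (dom (closure C2))).
Proof.
move=> s1 s2.
set A := adjoint C1; set B := adjoint C2.
have sA : linear_relation A by exact: linear_adjoint.
have sB : linear_relation B by exact: linear_adjoint.
pose M := @inl_pair X Y1 Y2 @` A; pose N := @inr_pair X Y1 Y2 @` B.
have oM : orth M = @fst_pair X Y1 Y2 @^-1` orth A.
  by apply: orth_image => p q; rewrite !inner_pair /= linear0l addr0.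
have oN : orth N = @snd_pair X Y1 Y2 @^-1` orth B.
  by apply: orth_image => p q; rewrite !inner_pair /= linear0l add0r.
have ooM : orth (orth M) = M.
  rewrite oM (@orth_preimage _ _ _ _ (@inl_pair X Y1 Y2)).
  - by rewrite orthK // closure_adjoint.
  - by [].
  - by move=> p q; rewrite !inner_pair /= linear0l addr0.
  - by case.
  - exact: (subspace0 (@subspace_orth _ _ _ A)).
have ooN : orth (orth N) = N.
  rewrite oN (@orth_preimage _ _ _ _ (@inr_pair X Y1 Y2)).
  - by rewrite orthK // closure_adjoint.
  - by [].
  - by move=> p q; rewrite !inner_pair /= linear0l add0r.
  - by case.
  - exact: (subspace0 (@subspace_orth _ _ _ B)).
have oMN : sumset (orth M) (orth N) =
    [set p | sumset (dom (closure C1)) (dom (closure C2)) p.2].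
  rewrite oM oN; apply/seteqP; split=> [_ [p Ap [q Bq <-]]|].
    exists p.2; first by apply/dom_biadjoint => //; exists p.1.1.
    by exists q.2 => //; apply/dom_biadjoint => //; exists q.1.2.
  move=> [[a b] c] [x /dom_biadjoint-/(_ s1)[y1 Ay1]].
  move=> [z /dom_biadjoint-/(_ s2)[y2 By2] /= <-].
  (* Each summand absorbs the other in its free coordinate. *)
  exists ((y1, b - y2), x) => //; exists ((a - y1, y2), z) => //.
  by congr ((_, _), _); rewrite /= ?subrK // addrC subrK.
have rowE : row_rel A B = sumset M N by exact: row_sumset.
clearbody M N.
have sM : subspace M by rewrite -ooM; exact: subspace_orth.
have sN : subspace N by rewrite -ooN; exact: subspace_orth.
rewrite -(closed_preimage_snd (Y1 * Y2)%type) -oMN rowE.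
split; first exact: closed_sum_orth.
move=> cMN; rewrite -ooM -ooN.
by apply: closed_sum_orth => //; exact: subspace_orth.
Qed.

End adjoint.

Theorem theorem3p6 (R : realType) (s : scalars)
    (H H1 H2 K K1 K2 : hilbertType (scalar_conj R s))
    (R1 : set (H1 * K)) (R2 : set (H2 * K))
    (C1 : set (H * K1)) (C2 : set (H * K2))
    (R1_lin : linear_relation R1) (R2_lin : linear_relation R2)
    (C1_lin : linear_relation C1) (C2_lin : linear_relation C2) :
  [/\ adjoint (row_rel R1 R2) = col_rel (adjoint R1) (adjoint R2),
      closure (row_rel (adjoint C1) (adjoint C2)) `<=` adjoint (col_rel C1 C2) /\
      (adjoint (col_rel C1 C2) = closure (row_rel (adjoint C1) (adjoint C2)) <->
       closure (col_rel C1 C2) = col_rel (closure C1) (closure C2)) &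
      closed (row_rel (adjoint C1) (adjoint C2)) <->
      closed [set x + y | x in dom (closure C1) & y in dom (closure C2)]].
Proof.
split; first exact: adjoint_row.
  by split; [exact: closure_row_sub_adjoint_col|exact: adjoint_col_eq].
exact: closed_row_adjoint.
Qed.
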